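(* Let $n\ge 2$ and fix a density matrix $\beta$ on $\mathbb{C}^n$ all of whose eigenvalues are strictly positive. For a unitary operator $U$ on $\mathbb{C}^n\otimes\mathbb{C}^n$ define the linear map $\Phi_U: M^n\to M^n$ by $\Phi_U(Q)=\mathrm{Tr}_2\big(U\,(Q\otimes\beta)\,U^*\big)$. Then there is an open and dense subset $\mathcal{O}$ of the group of unitary operators on $\mathbb{C}^n\otimes\mathbb{C}^n$ such that for every $U\in\mathcal{O}$ the map $\Phi_U$ has a unique fixed point $Q_{\Phi_U}$ in the set of density matrices, i.e. there is exactly one density matrix $Q$ with $\Phi_U(Q)=Q$.
   Context: $M^n$ denotes the space of $n\times n$ complex matrices. A density matrix is a positive semidefinite self-adjoint matrix of trace $1$. The partial trace $\mathrm{Tr}_2:\mathcal{L}(\mathbb{C}^n\otimes\mathbb{C}^n)\to M^n$ is the linear map determined by $\mathrm{Tr}_2(A\otimes B)=\mathrm{Tr}(B)\,A$. The topology on unitary operators is the usual one (on the matrix coefficients). *)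

(* Defs.v *)
From HB Require Import structures.
From mathcomp Require Import all_boot all_order all_algebra.
From mathcomp Require Import reals.
From mathcomp Require Import complex mxtens.
Set Implicit Arguments. Unset Strict Implicit. Unset Printing Implicit Defensive.
Import Order.TTheory GRing.Theory Num.Theory.
Local Open Scope ring_scope.
Local Open Scope complex_scope.

Definition adjmx (R : realType) m n (A : 'M[R[i]]_(m, n)) : 'M[R[i]]_(n, m) :=
  (map_mx (@conjc R) A)^T.

Definition selfadjoint (R : realType) n (A : 'M[R[i]]_n) : Prop := adjmx A = A.

Definition psd (R : realType) n (A : 'M[R[i]]_n) : Prop :=
  forall v : 'cV[R[i]]_n, 0 <= (adjmx v *m A *m v) 0 0.

Definition density_matrix (R : realType) n (A : 'M[R[i]]_n) : Prop :=
  [/\ selfadjoint A, psd A & \tr A = 1].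

Definition unitary (R : realType) n (U : 'M[R[i]]_n) : Prop :=
  U *m adjmx U = 1%:M /\ adjmx U *m U = 1%:M.

(* Partial trace over the second factor: Tr_2 (A *t B) = \tr B * A,
   using the index convention of mxtens ('I_(n*n) = 'I_n x 'I_n). *)
Definition ptrace2 (R : realType) n (X : 'M[R[i]]_(n * n)) : 'M[R[i]]_n :=
  \matrix_(i, j) \sum_(k < n) X (mxtens_index (i, k)) (mxtens_index (j, k)).

Definition PhiU (R : realType) n (beta : 'M[R[i]]_n) (U : 'M[R[i]]_(n * n))
  (Q : 'M[R[i]]_n) : 'M[R[i]]_n :=
  ptrace2 (U *m tensmx Q beta *m adjmx U).

Definition mx_close (R : realType) m n (e : R) (A B : 'M[R[i]]_(m, n)) : Prop :=
  forall i j, `|A i j - B i j| < e%:C.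

Definition open_in_unitary (R : realType) N (O : 'M[R[i]]_N -> Prop) : Prop :=
  (forall U, O U -> unitary U) /\
  forall U, O U -> exists2 e : R, 0 < e &
    forall V, unitary V -> mx_close e U V -> O V.

Definition dense_in_unitary (R : realType) N (O : 'M[R[i]]_N -> Prop) : Prop :=
  forall U, unitary U -> forall e : R, 0 < e -> exists V, O V /\ mx_close e U V.

(* Main.v *)
(* Let [G_U Q := Phi_U Q - Q + \tr Q *: beta].  It preserves the trace, and when it
   is invertible its preimage of [beta] is the unique fixed point of trace 1 of
   [Phi_U]; Cesaro averages of the orbit of [beta] converge to it, so it is positive.
   Invertibility of [G_U] is the nonvanishing of a determinant continuous in [U], an
   open condition.  It holds for the swap [S], since [Phi_S Q = \tr Q *: beta].
   Up to a phase, which does not change [Phi], [S] is joined to any unitary [U] by a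
   unitary curve rational in a real parameter [t] (Cayley transform); clearing
   denominators, the determinant becomes a polynomial in [t] not vanishing at the
   end [S], so it has nonzero values arbitrarily close to the end [U]. *)
Require Import Defs.
From HB Require Import structures.
From mathcomp Require Import all_boot all_order all_algebra.
From mathcomp Require Import fingroup perm spectral.
From mathcomp Require Import reals.
From mathcomp Require Import complex mxtens.
From mathcomp Require Import ring lra.
From mathcomp Require Import boolp classical_sets topology normedtype.
Import Order.TTheory GRing.Theory Num.Theory.
Local Open Scope ring_scope.
Local Open Scope complex_scope.
Import numFieldNormedType.Exports.
Set Implicit Arguments.
Unset Strict Implicit.
Unset Printing Implicit Defensive.

(** * Functions closed under ring operations and conjugation *)

(* Instantiated with the functions continuous at a point and with the
   polynomial functions of a real variable. *)
Record star_closed (R : realType) (T : Type) (P : (T -> R[i]) -> Prop) : Prop :=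
  StarClosed {
    star_cst : forall c, P (fun=> c);
    star_add : forall f g, P f -> P g -> P (fun t => f t + g t);
    star_mul : forall f g, P f -> P g -> P (fun t => f t * g t);
    star_conj : forall f, P f -> P (fun t => (f t)^*) }.

Section StarClosed.
Context {R : realType} {T : Type} {P : (T -> R[i]) -> Prop}.
Hypothesis HP : star_closed P.

Definition mx_in m n (A : T -> 'M[R[i]]_(m, n)) := forall i j, P (fun t => A t i j).

Lemma star_opp f : P f -> P (fun t => - f t).
Proof.
by move=> Pf; under eq_fun do rewrite -mulN1r; apply: star_mul => //; apply: star_cst.
Qed.

Lemma star_sum I (r : seq I) (Q : pred I) (F : I -> T -> R[i]) :
  (forall i, P (F i)) -> P (fun t => \sum_(i <- r | Q i) F i t).
Proof.
move=> PF; elim: r => [|i r IH].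
  by under eq_fun do rewrite big_nil; apply: star_cst.
under eq_fun do rewrite big_cons.
by case: (Q i) => //; apply: star_add.
Qed.

Lemma star_prod I (r : seq I) (Q : pred I) (F : I -> T -> R[i]) :
  (forall i, P (F i)) -> P (fun t => \prod_(i <- r | Q i) F i t).
Proof.
move=> PF; elim: r => [|i r IH].
  by under eq_fun do rewrite big_nil; apply: star_cst.
under eq_fun do rewrite big_cons.
by case: (Q i) => //; apply: star_mul.
Qed.

Lemma mx_in_cst m n (A : 'M[R[i]]_(m, n)) : mx_in (fun=> A).
Proof. by move=> i j; apply: star_cst. Qed.

Lemma mx_in_add m n (A B : T -> 'M[R[i]]_(m, n)) :
  mx_in A -> mx_in B -> mx_in (fun t => A t + B t).
Proof. by move=> PA PB i j; under eq_fun do rewrite mxE; apply: star_add. Qed.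

Lemma mx_in_scale m n f (A : T -> 'M[R[i]]_(m, n)) :
  P f -> mx_in A -> mx_in (fun t => f t *: A t).
Proof. by move=> Pf PA i j; under eq_fun do rewrite mxE; apply: star_mul. Qed.

Lemma mx_in_mul m n p (A : T -> 'M[R[i]]_(m, n)) (B : T -> 'M[R[i]]_(n, p)) :
  mx_in A -> mx_in B -> mx_in (fun t => A t *m B t).
Proof.
move=> PA PB i j; under eq_fun do rewrite mxE.
by apply: star_sum => k; apply: star_mul.
Qed.

Lemma mx_in_adjmx m n (A : T -> 'M[R[i]]_(m, n)) :
  mx_in A -> mx_in (fun t => adjmx (A t)).
Proof. by move=> PA i j; under eq_fun do rewrite !mxE; apply: star_conj. Qed.

Lemma star_det n (A : T -> 'M[R[i]]_n) : mx_in A -> P (fun t => \det (A t)).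
Proof.
move=> PA; apply: star_sum => s.
by apply: (star_mul HP (star_cst HP ((-1) ^+ perm.odd_perm s))); apply: star_prod.
Qed.

(** The adjugate stands in for the inverse, up to the determinant, without any division. *)
Lemma mx_in_adjugate n (A : T -> 'M[R[i]]_n) :
  mx_in A -> mx_in (fun t => \adj (A t)).
Proof.
move=> PA i j; under eq_fun do rewrite mxE.
apply: (star_mul HP (star_cst HP ((-1) ^+ (j + i)))).
by apply: star_det => k l; under eq_fun do rewrite !mxE.
Qed.

End StarClosed.

(** * Limits along a filter *)

Section Tendsto.
Context {K : numFieldType} {T : Type} {F : set_system T} {FF : Filter F}.

(* Stated over an abstract [K] because the canonical topology of a
   [numFieldType] is not inferred on the concrete type [R[i]]. *)
Definition tendsto (f : T -> K) (a : K) : Prop := (f @ F --> a)%classic.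

Lemma tendstoP (f : T -> K) (a : K) :
  tendsto f a <-> forall e, 0 < e -> F [set t | `|a - f t| < e]%classic.
Proof. exact: cvgrPdist_lt. Qed.

Lemma tendsto_cst (a : K) : tendsto (fun=> a) a.
Proof. exact: cvg_cst. Qed.

Lemma tendstoD f g a b :
  tendsto f a -> tendsto g b -> tendsto (fun t => f t + g t) (a + b).
Proof. exact: cvgD. Qed.

Lemma tendstoM f g a b :
  tendsto f a -> tendsto g b -> tendsto (fun t => f t * g t) (a * b).
Proof. exact: cvgM. Qed.

Lemma tendstoV f a : a != 0 -> tendsto f a -> tendsto (fun t => (f t)^-1) a^-1.
Proof. exact: cvgV. Qed.

End Tendsto.
Arguments tendsto {K T} F f a.

(** When [F] is the neighborhood filter of [x] this is continuity at [x]; conjugation is handled as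
    an isometry. *)
Lemma star_closed_tendsto (R : realType) (T : Type) (F : set_system T) (x : T) :
  Filter F -> star_closed (fun f : T -> R[i] => tendsto F f (f x)).
Proof.
move=> FF; split.
- by move=> c; apply: tendsto_cst.
- by move=> f g; apply: tendstoD.
- by move=> f g; apply: tendstoM.
- move=> f /tendstoP cf; apply/tendstoP => e e0.
  by apply: filterS (cf e e0) => y /=; rewrite -rmorphB norm_conjC.
Qed.

(** * Polynomial functions of a real variable *)

Definition real_polyfun (R : realType) (f : R -> R[i]) : Prop :=
  exists p : {poly R[i]}, forall t, f t = p.[t%:C].

(** Conjugation passes to the coefficients because it fixes [t%:C]; this is why the variable is
    real. *)
Lemma star_closed_real_polyfun (R : realType) : star_closed (@real_polyfun R).
Proof.
split.
- by move=> c; exists c%:P => t; rewrite hornerC.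
- by move=> f g [p fE] [q gE]; exists (p + q) => t; rewrite hornerD fE gE.
- by move=> f g [p fE] [q gE]; exists (p * q) => t; rewrite hornerM fE gE.
- move=> f [p fE]; exists (map_poly conjc p) => t.
  by rewrite fE -{2}[t%:C]conjc_real horner_map.
Qed.

Lemma exists_nonroot (F : fieldType) (p : {poly F}) (f : nat -> F) :
  p != 0 -> injective f -> exists k, ~~ root p (f k).
Proof.
move=> p0 fI; apply/not_existsP => H.
have := @max_poly_roots _ p (map f (iota 0 (size p))) p0.
rewrite size_map size_iota ltnn map_inj_uniq // iota_uniq => Hroots.
suff: false by []; apply: Hroots => //; apply/allP => _ /mapP[k _ ->].
apply/negPn/negP; exact: H.
Qed.

Lemma real_polyfun_neq0_near0 (R : realType) (f : R -> R[i]) (s d : R) :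
  real_polyfun f -> f s != 0 -> 0 < d -> exists t, [/\ 0 < t, t < d & f t != 0].
Proof.
move=> [p fE] fs d0.
have p0 : p != 0 by apply: contraNneq fs => p0; rewrite fE p0 horner0.
(* [k.+2] keeps the point strictly below [d] even at [k = 0]. *)
have fI : injective (fun k => (d / k.+2%:R)%:C).
  move=> i j /complexI /(mulfI (lt0r_neq0 d0)) /invr_inj /eqP.
  by rewrite eqr_nat => /eqP [].
have [k] := exists_nonroot p0 fI; rewrite rootE -fE => fk.
exists (d / k.+2%:R); split=> //.
  by rewrite divr_gt0 ?ltr0n.
by rewrite ltr_pdivrMr ?ltr0n // ltr_pMr // ltr1n.
Qed.

(** * Adjoint, unitary, positive semidefinite and density matrices *)

Section Adjoint.
Context {R : realType}.
Local Notation C := R[i].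

Lemma adjmxE m n (A : 'M[C]_(m, n)) i j : adjmx A i j = (A j i)^*.
Proof. by rewrite !mxE. Qed.

Lemma adjmxK m n (A : 'M[C]_(m, n)) : adjmx (adjmx A) = A.
Proof. by apply/matrixP => i j; rewrite !adjmxE conjcK. Qed.

Lemma adjmxM m n p (A : 'M[C]_(m, n)) (B : 'M[C]_(n, p)) :
  adjmx (A *m B) = adjmx B *m adjmx A.
Proof. by rewrite /adjmx map_mxM trmx_mul. Qed.

Lemma adjmxD m n (A B : 'M[C]_(m, n)) : adjmx (A + B) = adjmx A + adjmx B.
Proof. by rewrite /adjmx map_mxD linearD. Qed.

Lemma adjmxZ m n a (A : 'M[C]_(m, n)) : adjmx (a *: A) = a^* *: adjmx A.
Proof. by rewrite /adjmx map_mxZ linearZ. Qed.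

Lemma adjmx1 n : adjmx (1%:M : 'M[C]_n) = 1%:M.
Proof. by rewrite /adjmx map_mx1 trmx1. Qed.

Lemma adjmx_tens m n p q (A : 'M[C]_(m, n)) (B : 'M[C]_(p, q)) :
  adjmx (A *t B) = adjmx A *t adjmx B.
Proof. by rewrite /adjmx map_mxT trmx_tens. Qed.

Lemma mxtrace_adjmx n (A : 'M[C]_n) : \tr (adjmx A) = (\tr A)^*.
Proof. by rewrite /mxtrace rmorph_sum; apply: eq_bigr => i _; rewrite adjmxE. Qed.

Lemma unitary_mul n (A B : 'M[C]_n) : unitary A -> unitary B -> unitary (A *m B).
Proof.
move=> [A1 A2] [B1 B2]; split; rewrite adjmxM !mulmxA.
  by rewrite -(mulmxA A) B1 mulmx1.
by rewrite -(mulmxA (adjmx B)) A2 mulmx1.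
Qed.

Lemma unitary_adjmx n (A : 'M[C]_n) : unitary A -> unitary (adjmx A).
Proof. by move=> [A1 A2]; split; rewrite adjmxK. Qed.

Lemma unitary_scale n (z : C) (A : 'M[C]_n) :
  z * z^* = 1 -> unitary A -> unitary (z *: A).
Proof.
move=> zz [A1 A2].
by split; rewrite adjmxZ -scalemxAl -scalemxAr scalerA 1?(mulrC _ z) zz scale1r.
Qed.

Lemma psd_conj m n (M : 'M[C]_(m, n)) (A : 'M[C]_n) :
  psd A -> psd (M *m A *m adjmx M).
Proof. by move=> pA v; have := pA (adjmx M *m v); rewrite adjmxM adjmxK !mulmxA. Qed.

Lemma psd_sum n I (r : seq I) (F : I -> 'M[C]_n) :
  (forall i, psd (F i)) -> psd (\sum_(i <- r) F i).
Proof.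
move=> pF v; rewrite mulmx_sumr mulmx_suml summxE; apply: sumr_ge0 => i _; exact: pF.
Qed.

Lemma psd_diag_ge0 n (A : 'M[C]_n) i : psd A -> 0 <= A i i.
Proof.
move=> /(_ (delta_mx i 0)).
have -> : adjmx (delta_mx i 0 : 'M[C]_(n, 1)) = delta_mx 0 i.
  by apply/matrixP => k l; rewrite adjmxE !mxE andbC rmorph_nat.
by rewrite -rowE -colE !mxE.
Qed.

(** Spectral theorem: if [A = P^* D P], take [B = P^* sqrt D]. The eigenvalues are nonnegative as
    diagonal entries of [P A P^*]. *)
Lemma psd_factor n (A : 'M[C]_n) : selfadjoint A -> psd A ->
  exists B : 'M[C]_n, A = B *m adjmx B.
Proof.
move=> sA pA; pose P := spectralmx A; pose d := spectral_diag A.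
have tE m (M : 'M[C]_(m, n)) : map_mx Num.conj (M^T) = adjmx M by rewrite -map_trmx.
have Pu : P *m adjmx P = 1%:M by rewrite -tE; exact/unitarymxP/spectral_unitarymx.
have Pu' : adjmx P *m P = 1%:M by exact: mulmx1C.
have AE : A = adjmx P *m diag_mx d *m P.
  have /orthomx_spectralP : A \is normalmx by apply/normalmxP; rewrite tE sA.
  rewrite invmx_unitary; last exact: spectral_unitarymx.
  by rewrite tE; apply.
have d0 i : 0 <= d 0 i.
  have := psd_diag_ge0 i (psd_conj P pA); rewrite {1}AE !mulmxA Pu mul1mx.
  by rewrite -mulmxA Pu mulmx1 mxE eqxx mulr1n.
exists (adjmx P *m diag_mx (map_mx sqrtC d)); rewrite adjmxM adjmxK {1}AE.
rewrite !mulmxA; congr (_ *m _); rewrite -mulmxA; congr (_ *m _).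
have -> : adjmx (diag_mx (map_mx sqrtC d)) = diag_mx (map_mx sqrtC d).
  apply/matrixP => i j; rewrite adjmxE !mxE eq_sym.
  case: eqP => [->|_]; rewrite ?mulr1n ?mulr0n ?conjc0 //.
  by apply: (CrealP _); rewrite ger0_real // sqrtC_ge0.
rewrite mulmx_diag; congr diag_mx; apply/rowP => i.
by rewrite !mxE -expr2 sqrtCK.
Qed.

Lemma psd_offdiag n (A : 'M[C]_n) i j : selfadjoint A -> psd A ->
  `|A i j| *+ 2 <= A i i + A j j.
Proof.
move=> sA pA; have [->|Aij0] := eqVneq (A i j) 0.
  by rewrite normr0 mul0rn addr_ge0 ?psd_diag_ge0.
(* A phase chosen so that, on the test vector [e_i + c e_j], both cross terms become [- |A i j|]. *)
pose c := - (`|A i j| / A i j).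
have cc : c^* * c = 1.
  have -> : c^* * c = `|c| ^+ 2 by rewrite normCK mulrC.
  rewrite normrN normf_div normr_id divff ?expr1n //.
  by rewrite normr_eq0.
have := pA (delta_mx i 0 + c *: delta_mx j 0).
rewrite adjmxD adjmxZ.
have adj_delta k : adjmx (delta_mx k 0 : 'M[C]_(n, 1)) = delta_mx 0 k.
  by apply/matrixP => a b; rewrite adjmxE !mxE andbC rmorph_nat.
have dE k l : (delta_mx 0 k *m A *m delta_mx l (0 : 'I_1)) (0 : 'I_1) 0 = A k l.
  by rewrite -rowE -colE !mxE.
rewrite !adj_delta !(mulmxDl, mulmxDr) -!(scalemxAl, scalemxAr) scalerA.
have addE (X Y : 'M[C]_1) : (X + Y) 0 0 = X 0 0 + Y 0 0 by rewrite mxE.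
have sclE a (X : 'M[C]_1) : (a *: X) 0 0 = a * X 0 0 by rewrite mxE.
rewrite !(addE, sclE) !dE cc mul1r.
have -> : A j i = (A i j)^* by rewrite -adjmxE sA.
have -> : c * A i j = - `|A i j| by rewrite mulNr divfK.
have -> : c^* * (A i j)^* = - `|A i j|.
  rewrite -rmorphM mulNr divfK // rmorphN; congr (- _).
  by apply: (CrealP _); rewrite normr_real.
rewrite [X in 0 <= X](_ : _ = A i i + A j j - `|A i j| *+ 2) ?subr_ge0 //.
by rewrite mulr2n opprD [RHS]addrACA [A j j - _]addrC.
Qed.

Lemma density_entry_le1 n (A : 'M[C]_n) i j : density_matrix A -> `|A i j| <= 1.
Proof.
move=> [sA pA trA].
have diag1 k : A k k <= 1.
  by rewrite -trA /mxtrace (bigD1 k) //= lerDl sumr_ge0 // => l _; apply: psd_diag_ge0.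
by rewrite -(ler_pMn2r (n := 2)) // (le_trans (psd_offdiag i j sA pA)) // lerD.
Qed.

End Adjoint.

(** * Partial trace, positivity of the channel, and the swap *)

Lemma sum_mxtens (V : nmodType) m n (F : 'I_(m * n) -> V) :
  \sum_k F k = \sum_i \sum_j F (mxtens_index (i, j)).
Proof.
rewrite pair_bigA /= (reindex (@mxtens_index m n)) /=.
  by apply: eq_bigr => -[i j] _.
exists (@mxtens_unindex m n) => k _; [exact: mxtens_indexK | exact: mxtens_unindexK].
Qed.

Section Channel.
Context {R : realType} {n : nat}.
Local Notation C := R[i].
Implicit Types (beta Q : 'M[C]_n) (X U : 'M[C]_(n * n)).

Lemma ptrace2_linear : linear (@ptrace2 R n).
Proof.
move=> a X Y; apply/matrixP => i j; rewrite !mxE mulr_sumr -big_split.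
by apply: eq_bigr => k _; rewrite !mxE.
Qed.

HB.instance Definition _ := GRing.isLinear.Build C 'M[C]_(n * n) 'M[C]_n _
  (@ptrace2 R n) ptrace2_linear.

Lemma mxtrace_ptrace2 X : \tr (ptrace2 X) = \tr X.
Proof. by rewrite /mxtrace sum_mxtens; apply: eq_bigr => i _; rewrite mxE. Qed.

Lemma mxtrace_tens Q beta : \tr (Q *t beta) = \tr Q * \tr beta.
Proof.
rewrite /mxtrace sum_mxtens mulr_suml; apply: eq_bigr => i _.
by rewrite mulr_sumr; apply: eq_bigr => j _; rewrite tensmxE.
Qed.

Lemma PhiU_linear beta X : linear (PhiU beta X).
Proof.
move=> a Q Q'; rewrite /PhiU -linearP; congr ptrace2.
have -> : (a *: Q + Q') *t beta = a *: (Q *t beta) + Q' *t beta.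
  by apply/matrixP => i j; rewrite !mxE mulrDl mulrA.
by rewrite mulmxDr mulmxDl -scalemxAr -scalemxAl.
Qed.

HB.instance Definition _ beta X := GRing.isLinear.Build C 'M[C]_n 'M[C]_n _
  (PhiU beta X) (PhiU_linear beta X).

Lemma PhiU_scale beta c X Q : PhiU beta (c *: X) Q = (c * c^*) *: PhiU beta X Q.
Proof.
rewrite /PhiU adjmxZ -!scalemxAl -scalemxAr scalerA; exact: linearZ.
Qed.

Lemma mxtrace_PhiU beta U Q : unitary U -> \tr (PhiU beta U Q) = \tr Q * \tr beta.
Proof.
by move=> [_ UU]; rewrite mxtrace_ptrace2 mxtrace_mulC mulmxA UU mul1mx mxtrace_tens.
Qed.

Lemma adjmx_ptrace2 X : adjmx (ptrace2 X) = ptrace2 (adjmx X).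
Proof.
apply/matrixP => i j; rewrite adjmxE !mxE rmorph_sum.
by apply: eq_bigr => k _; rewrite adjmxE.
Qed.

Lemma adjmx_PhiU beta X Q : selfadjoint beta ->
  adjmx (PhiU beta X Q) = PhiU beta X (adjmx Q).
Proof.
by move=> sb; rewrite adjmx_ptrace2 !adjmxM adjmxK adjmx_tens sb mulmxA.
Qed.

(** The operator [1 *t e_k^T], contracting the second factor with the basis vector [e_k]. *)
Definition slice (k : 'I_n) : 'M[C]_(n, n * n) :=
  \matrix_(i, a) (a == mxtens_index (i, k))%:R.

(** Operator-sum (Kraus) form, which makes positivity visible. *)
Lemma ptrace2_slice X : ptrace2 X = \sum_k slice k *m X *m adjmx (slice k).
Proof.
apply/matrixP => i j; rewrite summxE mxE; apply: eq_bigr => k _.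
rewrite mxE (bigD1 (mxtens_index (j, k))) //= big1 ?addr0 => [|a /negPf ak].
  rewrite mxE (bigD1 (mxtens_index (i, k))) //= big1 => [|b /negPf bk].
    by rewrite adjmxE !mxE !eqxx conjc1 mul1r mulr1 addr0.
  by rewrite mxE bk mul0r.
by rewrite adjmxE !mxE ak conjc0 mulr0.
Qed.

Lemma tensmx1_slice Q : Q *t (1%:M : 'M_n) = \sum_k adjmx (slice k) *m Q *m slice k.
Proof.
apply/matrixP => a b; rewrite -[a]mxtens_unindexK -[b]mxtens_unindexK.
case: (mxtens_unindex a) (mxtens_unindex b) => i k [j l].
rewrite tensmxE summxE (bigD1 k) //= big1 ?addr0 => [|k' /negPf kk'].
  rewrite [RHS]mxE (bigD1 j) //= big1 ?addr0 => [|j' /negPf jj'].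
    rewrite [in RHS]mxE (bigD1 i) //= big1 ?addr0 => [|i' /negPf ii'].
      rewrite adjmxE !mxE eqxx conjc1 mul1r (inj_eq (can_inj (@mxtens_indexK n n))).
      by rewrite xpair_eqE eqxx eq_sym.
    rewrite adjmxE mxE (inj_eq (can_inj (@mxtens_indexK n n))) xpair_eqE.
    by rewrite eq_sym ii' conjc0 mul0r.
  rewrite [slice _ _ _]mxE (inj_eq (can_inj (@mxtens_indexK n n))) xpair_eqE.
  by rewrite [j == _]eq_sym jj' mulr0.
rewrite -mulmxA mxE big1 // => i' _; rewrite adjmxE mxE.
by rewrite (inj_eq (can_inj (@mxtens_indexK n n))) xpair_eqE [k == _]eq_sym kk' andbF
  conjc0 mul0r.
Qed.

(** With [beta = B B^*], [Q *t beta] is the conjugate of [Q *t 1] by [1 *t B]. Every stage of [PhiU]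
    is then a sum of conjugations, which preserve positivity. *)
Lemma psd_PhiU beta X Q : selfadjoint beta -> psd beta -> psd Q ->
  psd (PhiU beta X Q).
Proof.
move=> sb pb pQ; have [B BE] := psd_factor sb pb.
rewrite /PhiU ptrace2_slice; apply: psd_sum => k; do 2!apply: psd_conj.
have -> : Q *t beta = (1%:M *t B) *m (Q *t 1%:M) *m adjmx (1%:M *t B).
  by rewrite adjmx_tens adjmx1 !tensmx_mul !mul1mx !mulmx1 -BE.
apply: psd_conj; rewrite tensmx1_slice; apply: psd_sum => l.
by rewrite -{2}[slice l]adjmxK; apply: psd_conj.
Qed.

Lemma density_PhiU beta U Q : density_matrix beta -> unitary U ->
  density_matrix Q -> density_matrix (PhiU beta U Q).
Proof.
move=> [sb pb tb] uU [sQ pQ tQ]; split.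
- by rewrite /selfadjoint adjmx_PhiU; [rewrite sQ | exact: sb].
- exact: psd_PhiU.
- by rewrite mxtrace_PhiU // tQ tb mulr1.
Qed.

Definition swap_index (a : 'I_(n * n)) : 'I_(n * n) :=
  mxtens_index ((mxtens_unindex a).2, (mxtens_unindex a).1).

Lemma swap_indexK : involutive swap_index.
Proof. by move=> a; rewrite /swap_index mxtens_indexK mxtens_unindexK. Qed.

Definition swapmx : 'M[C]_(n * n) := perm_mx (perm (can_inj swap_indexK)).

Lemma unitary_swapmx : unitary swapmx.
Proof.
have -> : unitary swapmx <-> swapmx *m swapmx^T = 1%:M /\ swapmx^T *m swapmx = 1%:M.
  by rewrite /unitary /adjmx map_perm_mx.
by rewrite tr_perm_mx -!perm_mxM mulVg mulgV perm_mx1.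
Qed.

(** Conjugation by the swap turns [Q *t beta] into [beta *t Q]; tracing out the second factor leaves
    the scalar [\tr Q]. *)
Lemma PhiU_swapmx beta Q : PhiU beta swapmx Q = \tr Q *: beta.
Proof.
apply/matrixP => i j; rewrite mxE.
have -> : adjmx swapmx = perm_mx (perm (can_inj swap_indexK))^-1.
  by rewrite /adjmx map_perm_mx tr_perm_mx.
rewrite -row_permE -col_permE mxE mulr_suml; apply: eq_bigr => k _.
by rewrite !mxE !permE /swap_index !mxtens_indexK.
Qed.

End Channel.

(** * The defect map and the fixed point *)

Section Defect.
Context {R : realType} {n : nat}.
Local Notation C := R[i].
Variable beta : 'M[C]_n.
Hypothesis dbeta : density_matrix beta.

(* For [X] unitary and [d = 1] the trace of the defect of [Q] is [\tr Q]: the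
   defect is injective iff [PhiU beta X] has no nonzero traceless fixed point.
   The scale [d] makes it homogeneous in [X]. *)
Definition defect (X : 'M[C]_(n * n)) (d : C) (Q : 'M[C]_n) : 'M[C]_n :=
  PhiU beta X Q - d *: (Q - \tr Q *: beta).

Lemma defect_linear X d : linear (defect X d).
Proof.
move=> a Q Q'; rewrite /defect linearP linearP /= scalerDl -scalerA.
move: (PhiU beta X Q) (PhiU beta X Q') (\tr Q) (\tr Q') => P P' s s'.
by apply/matrixP => i j; rewrite !mxE; ring.
Qed.

HB.instance Definition _ X d := GRing.isLinear.Build C 'M[C]_n 'M[C]_n _
  (defect X d) (defect_linear X d).

Definition defect_mx X d : 'M[C]_(n * n) := lin_mx (defect X d).

Lemma defect_inj X d : \det (defect_mx X d) != 0 -> injective (defect X d).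
Proof.
move=> detX Q Q' QQ'; apply: (can_inj mxvecK).
have : defect_mx X d \in unitmx by rewrite unitmxE unitfE.
rewrite -row_free_unit => /row_free_inj; apply.
by rewrite /defect_mx !mul_vec_lin /= QQ'.
Qed.

Lemma defect_surj X d Q : \det (defect_mx X d) != 0 -> exists Q', defect X d Q' = Q.
Proof.
move=> detX; exists (vec_mx (mxvec Q *m invmx (defect_mx X d))).
by rewrite -mx_rV_lin mulmxKV ?mxvecK // unitmxE unitfE.
Qed.

Lemma det_defect_neq0 X d :
  (forall Q, defect X d Q = 0 -> Q = 0) -> \det (defect_mx X d) != 0.
Proof.
move=> H; apply/det0P => -[v v0 vX]; case/eqP: v0.
apply: (can_inj vec_mxK); rewrite linear0; apply: H.
by rewrite -mx_rV_lin vX linear0.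
Qed.

(** [PhiU] picks up the factor [|c|^2]. Used both to discard a phase and to clear a common
    denominator. *)
Lemma defect_mx_scale c X d :
  defect_mx (c *: X) (c * c^* * d) = (c * c^*) *: defect_mx X d.
Proof.
apply/row_matrixP => i; rewrite [RHS]linearZ /= !rowE.
rewrite /defect_mx !mul_rV_lin /= /defect PhiU_scale -[_ * d *: _]scalerA -scalerBr.
exact: linearZ.
Qed.

Lemma mxtrace_defect U Q : unitary U -> \tr (defect U 1 Q) = \tr Q.
Proof.
move=> uU; have [_ _ tb] := dbeta.
by rewrite /defect scale1r !linearB /= mxtrace_PhiU // mxtraceZ tb mulr1 opprK addNr addr0.
Qed.

Lemma defect_fixpoint U Q : unitary U ->
  (\tr Q = 1 /\ PhiU beta U Q = Q) <-> defect U 1 Q = beta.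
Proof.
move=> uU; split=> [[tQ PQ]|DQ].
  by rewrite /defect PQ tQ !scale1r opprB addrC subrK.
have tQ : \tr Q = 1 by rewrite -(mxtrace_defect Q uU) DQ; case: dbeta.
split=> //; move: (congr1 (+%R^~ (Q - beta)) DQ).
by rewrite /defect tQ !scale1r /= subrK [beta + _]addrC subrK.
Qed.

(** A kernel element is traceless because the defect preserves the trace; [PhiU beta swapmx] kills
    it, so its defect is [- Q]. *)
Lemma det_defect_swapmx : \det (defect_mx swapmx 1) != 0.
Proof.
apply: det_defect_neq0 => Q DQ.
have tQ : \tr Q = 0 by rewrite -(mxtrace_defect Q unitary_swapmx) DQ linear0.
move: DQ; rewrite /defect PhiU_swapmx tQ scale0r subr0 scale1r add0r.
by move/eqP; rewrite oppr_eq0 => /eqP.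
Qed.

(* With [rho_k := Phi^k(beta)] and [S_N := \sum_(k < N) rho_k], telescoping
   gives [defect (S_N - N Q) = rho_N - beta], which stays bounded; hence
   [v^* Q v >= - c / N] for every [N]. *)
Lemma psd_fixpoint U Q : unitary U -> \det (defect_mx U 1) != 0 ->
  selfadjoint Q -> defect U 1 Q = beta -> psd Q.
Proof.
move=> uU detU sQ DQ v.
pose rho k := iter k (PhiU beta U) beta.
have drho k : density_matrix (rho k) by elim: k => //= k; apply: density_PhiU.
pose f (A : 'M[C]_n) := (adjmx v *m A *m v) 0 0.
have fD A B : f (A + B) = f A + f B by rewrite /f mulmxDr mulmxDl mxE.
have fZ a A : f (a *: A) = a * f A by rewrite /f -scalemxAr -scalemxAl mxE.
(* [g] is [f] composed with the inverse of the defect. *)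
pose g (A : 'M[C]_n) := f (vec_mx (mxvec A *m invmx (defect_mx U 1))).
have gD A B : g (A + B) = g A + g B by rewrite /g linearD mulmxDl linearD fD.
have gZ a A : g (a *: A) = a * g A by rewrite /g linearZ -scalemxAl linearZ fZ.
have g0 : g 0 = 0 by rewrite -(scale0r 0) gZ mul0r.
have gE A : g (defect U 1 A) = f A.
  by rewrite /g -mul_vec_lin mulmxK ?mxvecK // unitmxE unitfE.
(* Density matrices have entries of modulus at most 1, so this one constant bounds [g] on the whole
   orbit. *)
pose c := \sum_i \sum_j `|g (delta_mx i j)|.
have grho k : `|g (rho k)| <= c.
  rewrite [rho k]matrix_sum_delta (big_morph g gD g0).
  apply: le_trans (ler_norm_sum _ _ _) (ler_sum _ _) => i _.
  rewrite (big_morph g gD g0).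
  apply: le_trans (ler_norm_sum _ _ _) (ler_sum _ _) => j _.
  by rewrite gZ normrM ler_piMl // density_entry_le1.
have DS N : defect U 1 (\sum_(k < N) rho k) = rho N - beta + N%:R *: beta.
  elim: N => [|N IH]; first by rewrite big_ord0 linear0 scale0r addr0 subrr.
  rewrite big_ord_recr linearD /= IH /defect; have [_ _ ->] := drho N.
  rewrite -[PhiU _ _ _]/(rho N.+1); move: (rho N) (rho N.+1) => P P'.
  by apply/matrixP => i j; rewrite !mxE; ring.
have bound N : `|\sum_(k < N) f (rho k) - N%:R * f Q| <= c *+ 2.
  have f0 : f 0 = 0 by rewrite -(scale0r 0) fZ mul0r.
  rewrite -(big_morph f fD f0) -!gE DQ DS gD gZ addrK -scaleN1r gD gZ.
  rewrite mulr2n (le_trans (ler_normD _ _)) // normrM normrN1 mul1r.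
  by rewrite lerD // (grho 0).
have fS N : 0 <= \sum_(k < N) f (rho k).
  by apply: sumr_ge0 => k _; have [_ + _] := drho k; apply.
(* The order on [R[i]] is partial: [f Q] must be known to be real before failure of [0 <= f Q] means
   that it is negative. *)
have fQ_real : f Q \is Num.real.
  apply/CrealP; rewrite -[LHS]/((f Q)^*) /f -adjmxE !adjmxM adjmxK mulmxA.
  by rewrite [adjmx Q]sQ.
have c2_real : c *+ 2 \is Num.real by rewrite ger0_real // (le_trans _ (bound 0%N)).
rewrite -[_ 0 0]/(f Q); have /complex_realP[x xE] := fQ_real.
have /complex_realP[y yE] := c2_real.
rewrite xE lecR leNgt; apply/negP => x_lt0.
have xN N : N%:R * - x <= y.
  have NxE : - (N%:R * f Q) = (N%:R * - x)%:C.
    by rewrite xE rmorphM rmorphN rmorph_nat mulrN.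
  rewrite -lecR -yE (le_trans _ (bound N)) // NxE ger0_norm ?lerDr //.
  by rewrite addr_ge0 // ler0c mulr_ge0 // oppr_ge0 ltW.
have y_ge0 : 0 <= y / - x.
  by rewrite divr_ge0 ?oppr_ge0 ?(ltW x_lt0) // -ler0c -yE (le_trans _ (bound 0%N)).
have := archi_boundP y_ge0.
by rewrite ltr_pdivrMr ?oppr_gt0 // ltNge xN.
Qed.

Lemma unique_fixpoint U : unitary U -> \det (defect_mx U 1) != 0 ->
  exists! Q, density_matrix Q /\ PhiU beta U Q = Q.
Proof.
move=> uU detU; have [sb _ tb] := dbeta.
have [Q DQ] := defect_surj beta detU.
have [tQ PQ] := (defect_fixpoint Q uU).2 DQ.
(* The adjoint of [Q] is also a fixed point of trace 1, so injectivity of the defect identifies it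
   with [Q]. *)
have sQ : selfadjoint Q.
  apply: (defect_inj detU); rewrite DQ; apply/(defect_fixpoint _ uU).
  by rewrite mxtrace_adjmx tQ conjc1 -adjmx_PhiU // PQ.
exists Q; split=> [|Q' [[_ _ tQ'] PQ']].
  by split=> //; split=> //; apply: (psd_fixpoint uU detU sQ DQ).
by apply: (defect_inj detU); rewrite DQ; apply/esym/(defect_fixpoint _ uU).
Qed.

End Defect.

(** * Entrywise neighborhoods and openness *)

Section Neighborhoods.
Context {R : realType}.
Local Notation C := R[i].

(** A positive element of [R[i]] has zero imaginary part, so complex tolerances reduce to real
    ones. *)
Lemma ReC_gt0 (e : C) : 0 < e -> exists2 r : R, 0 < r & e = r%:C.
Proof. by case: e => r s; rewrite ltcE /= => /andP[/eqP -> r0]; exists r. Qed.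

Lemma tendsto_neq0 (T : Type) (F : set_system T) (f : T -> C) (a : C) :
  Filter F -> tendsto F f a -> a != 0 -> F [set t | f t != 0]%classic.
Proof.
move=> FF /tendstoP fa a0; apply: filterS (fa `|a| _); last by rewrite normr_gt0.
by move=> t /=; apply: contraTneq => ->; rewrite subr0 ltxx.
Qed.

(** Membership of a set in this filter supplies the radius that [open_in_unitary] asks for. *)
Definition near_mx m n (U : 'M[C]_(m, n)) : set_system 'M[C]_(m, n) :=
  fun A => exists2 e : R, 0 < e & forall V, mx_close e U V -> A V.

#[export] Instance near_mx_filter m n (U : 'M[C]_(m, n)) : Filter (near_mx U).
Proof.
split.
- by exists 1.
- move=> A B [d d0 dA] [e e0 eB]; exists (Num.min d e).
    by rewrite lt_min d0.
  move=> V UV; split; [apply: dA | apply: eB] => i j.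
    by apply: lt_le_trans (UV i j) _; rewrite lecR ge_min lexx.
  by apply: lt_le_trans (UV i j) _; rewrite lecR ge_min lexx orbT.
- by move=> A B AB [e e0 eA]; exists e => // V /eA /AB.
Qed.

Lemma tendsto_near_mx m n (U : 'M[C]_(m, n)) i j :
  tendsto (near_mx U) (fun V => V i j) (U i j).
Proof.
by apply/tendstoP => _ /ReC_gt0[r r0 ->]; exists r => // V; apply.
Qed.

Lemma tendsto_real_complex : tendsto (nbhs (0 : R)) (fun t => t%:C) 0.
Proof.
apply/tendstoP => _ /ReC_gt0[r r0 ->]; apply/nbhs_ballP; exists r => // t.
rewrite /ball /= !sub0r normrN => tr.
by rewrite normrN normc_def /= expr0n addr0 sqrtr_sqr ltcR.
Qed.

End Neighborhoods.

Section DefectEntries.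
Context {R : realType} {n : nat} {T : Type} {P : (T -> R[i]) -> Prop}.
Hypothesis HP : star_closed P.

Lemma mx_in_ptrace2 (X : T -> 'M[R[i]]_(n * n)) :
  mx_in (P := P) X -> mx_in (P := P) (fun t => ptrace2 (X t)).
Proof. by move=> PX i j; under eq_fun do rewrite mxE; apply: star_sum. Qed.

Lemma mx_in_defect_mx beta (X : T -> 'M[R[i]]_(n * n)) d :
  mx_in (P := P) X -> P d -> mx_in (P := P) (fun t => defect_mx beta (X t) (d t)).
Proof.
move=> PX Pd i j; case/mxvec_indexP: j => k l.
(* The defect is evaluated at a fixed basis matrix, so [t] enters only through [X] and [d]. *)
under eq_fun do rewrite mxE /= mxvecE /defect -scaleN1r.
apply: mx_in_add => //; last first.
  apply: mx_in_scale => //; first exact: star_cst.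
  by apply: mx_in_scale => //; apply: mx_in_cst.
apply: mx_in_ptrace2; apply: mx_in_mul => //; last exact: mx_in_adjmx.
by apply: mx_in_mul => //; apply: mx_in_cst.
Qed.

End DefectEntries.

Lemma open_good (R : realType) n (beta : 'M[R[i]]_n) :
  open_in_unitary (fun U : 'M[R[i]]_(n * n) =>
    unitary U /\ \det (defect_mx beta U 1) != 0).
Proof.
split=> [U [] //|U [uU detU]].
have SC := star_closed_tendsto R U (near_mx_filter U).
have Pd : tendsto (near_mx U) (fun V => \det (defect_mx beta V 1))
                              (\det (defect_mx beta U 1)).
  apply: (star_det SC (A := fun V => defect_mx beta V 1)).
  apply: (mx_in_defect_mx SC beta (X := fun V => V)); last exact: (star_cst SC).
  by move=> i j; apply: tendsto_near_mx.
have [e e0 He] := tendsto_neq0 _ Pd detU.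
exists e; first exact: e0.
move=> V uV UV; split; [exact: uV | exact: (He V UV)].
Qed.

(** * The Cayley curve of unitary matrices *)

Section Cayley.
Context {R : realType} {n : nat}.
Local Notation C := R[i].
Implicit Types (U W : 'M[C]_n).

(* If [W = e^(i h)], then [pencil (1 + t) (1 - t) W] times the inverse of
   [pencil (1 - t) (1 + t) W] is a unitary curve, rational in [t], joining [1]
   at [t = 0] to [W] at [t = 1]. *)
Definition pencil (a b : R) W : 'M[C]_n := a%:C *: W + b%:C *: 1%:M.

Lemma adjmx_mul_pencil (a b : R) W : unitary W ->
  adjmx (pencil a b W) *m pencil a b W = adjmx (pencil b a W) *m pencil b a W.
Proof.
have gram (r s : R) : adjmx W *m W = 1%:M ->
    adjmx (pencil r s W) *m pencil r s W =
    (r * r + s * s)%:C *: 1%:M + (r * s)%:C *: (W + adjmx W).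
  have cR (x : R) : Num.conj x%:C = x%:C by exact: conjc_real.
  move=> WW; rewrite /pencil adjmxD !adjmxZ adjmx1 !cR mulmxDl !mulmxDr.
  rewrite -!scalemxAl -!scalemxAr !mulmx1 !mul1mx WW rmorphD !rmorphM /=.
  move: (adjmx W) (r%:C) (s%:C) => W' x y.
  by apply/matrixP => i j; rewrite !mxE; ring.
by move=> [_ WW]; rewrite (gram a b WW) (gram b a WW) (mulrC b a) (addrC (b * b)).
Qed.

Lemma unitary_mul_invmx (A B : 'M[C]_n) :
  B \in unitmx -> adjmx A *m A = adjmx B *m B -> unitary (A *m invmx B).
Proof.
move=> uB AB.
have V1 : adjmx (A *m invmx B) *m (A *m invmx B) = 1%:M.
  rewrite adjmxM !mulmxA -(mulmxA _ (adjmx A)) AB mulmxA mulmxK //.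
  by rewrite -adjmxM mulmxV // adjmx1.
by split=> //; apply: mulmx1C.
Qed.

(** For unimodular [z], [z W + 1] is singular only if [- z^*] is an eigenvalue of [W]; infinitely
    many phases face finitely many eigenvalues. *)
Lemma exists_phase W : exists z : C, z * z^* = 1 /\ \det (z *: W + 1%:M) != 0.
Proof.
(* [(1 + i k) / (1 - i k)] is a number over its own conjugate, hence unimodular. *)
pose y (k : nat) : C := Complex 1 k%:R / Complex 1 (- k%:R).
have den0 (r : R) : Complex 1 r != 0 :> C by rewrite eq_complex /= oner_eq0.
have yI : injective y.
  move=> k l /eqP; rewrite eqr_div // eq_complex /= => /andP[_].
  rewrite !mul1r !mulr1 -subr_eq0 => /eqP kl.
  by apply/eqP; rewrite -(eqr_nat R); apply/eqP; lra.
have yy k : y k * (y k)^* = 1.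
  have conj1 (r : R) : Num.conj (Complex 1 r) = Complex 1 (- r) by [].
  rewrite /y rmorphM fmorphV /= !conj1 opprK mulf_div.
  by rewrite [X in _ / X]mulrC divff // mulf_neq0.
have [k yk] := exists_nonroot (monic_neq0 (char_poly_monic W)) yI.
exists (- Num.conj (y k)); split.
  by rewrite rmorphN /= conjCK mulrNN mulrC yy.
have -> : - Num.conj (y k) *: W + 1%:M = - Num.conj (y k) *: (W - (y k)%:M).
  rewrite scalerBr scaleNr; congr (_ + _).
  by rewrite scaleNr opprK scale_scalar_mx mulrC yy.
rewrite detZ mulf_neq0 //.
  rewrite expf_neq0 // oppr_eq0; apply/eqP => y0.
  by have /esym/eqP := yy k; rewrite y0 mulr0 oner_eq0.
rewrite -unitfE -unitmxE -row_free_unit -kermx_eq0.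
by move: yk; rewrite -eigenvalue_root_char /eigenvalue negbK.
Qed.

End Cayley.

(** * Density of the good unitaries *)

Lemma dense_good (R : realType) n (beta : 'M[R[i]]_n) : density_matrix beta ->
  dense_in_unitary (fun U : 'M[R[i]]_(n * n) =>
    unitary U /\ \det (defect_mx beta U 1) != 0).
Proof.
move=> dbeta U uU e e0.
have [z [zz detz]] := exists_phase (adjmx U *m swapmx).
(* The phase makes [W + 1], the denominator [B 0], invertible; and [U W] is the swap times [z], the
   far end of the curve. *)
pose W := z *: (adjmx U *m swapmx).
have uW : unitary W.
  by apply: unitary_scale => //; apply: unitary_mul unitary_swapmx; apply: unitary_adjmx.
pose A (t : R) := pencil (1 + t) (1 - t) W.
pose B (t : R) := pencil (1 - t) (1 + t) W.
pose b t := \det (B t).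
(* The adjugate replaces the inverse in [V t], so the entries of [X t] are polynomial in [t]. *)
pose X t := U *m A t *m \adj (B t).
pose V t := U *m (A t *m invmx (B t)).
have XV t : b t != 0 -> X t = b t *: V t.
  move=> bt; rewrite /X /V /invmx unitmxE unitfE bt mulmxA -scalemxAr scalerA.
  by rewrite mulfV // scale1r.
have uV t : b t != 0 -> unitary (V t).
  move=> bt; apply: unitary_mul => //; apply: unitary_mul_invmx.
    by rewrite unitmxE unitfE.
  exact: adjmx_mul_pencil.
have DXV t : b t != 0 ->
    defect_mx beta (X t) (b t * (b t)^*) = (b t * (b t)^*) *: defect_mx beta (V t) 1.
  by move=> bt; rewrite XV // -[X in defect_mx _ _ X]mulr1 defect_mx_scale.
(* The last factor makes [h t != 0] imply [b t != 0], hence that [V t] is unitary. *)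
pose h t := \det (defect_mx beta (X t) (b t * (b t)^*)) * b t.
(* Stated for an abstract [P]: it serves once for polynomial functions and once for continuity at
   0. *)
have entries (P : (R -> R[i]) -> Prop) : star_closed P -> P (fun t => t%:C) ->
    [/\ P b, mx_in (P := P) X & P h].
  move=> HP Pt.
  have Pp (f g : R -> R) : P (fun t => (f t)%:C) -> P (fun t => (g t)%:C) ->
      mx_in (P := P) (fun t => pencil (f t) (g t) W).
    by move=> Pf Pg; apply: (mx_in_add HP); apply: (mx_in_scale HP) => //; apply: mx_in_cst.
  have Pplus : P (fun t => (1 + t)%:C).
    under eq_fun do rewrite rmorphD; apply: (star_add HP (star_cst HP _)) => //.
  have Pminus : P (fun t => (1 - t)%:C).
    under eq_fun do rewrite rmorphB; apply: (star_add HP (star_cst HP _)) => //.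
    exact: star_opp.
  have PA : mx_in (P := P) A by apply: Pp.
  have PB : mx_in (P := P) B by apply: Pp.
  have Pb : P b by apply: star_det.
  have PX : mx_in (P := P) X.
    apply: (mx_in_mul HP); last exact: mx_in_adjugate.
    by apply: (mx_in_mul HP) => //; apply: mx_in_cst.
  split=> //; apply: (star_mul HP) => //; apply: star_det => //.
  apply: mx_in_defect_mx => //; apply: (star_mul HP) => //; exact: star_conj.
have polyX : real_polyfun (fun t : R => t%:C) by exists 'X => t; rewrite hornerX.
have [_ _ hpoly] := entries _ (star_closed_real_polyfun R) polyX.
have two0 : (2%:R : R[i]) != 0 by rewrite pnatr_eq0.
have B1 : B 1 = 2%:R%:M.
  rewrite /B /pencil subrr scale0r add0r -[1 + 1]/(2%:R : R) rmorph_nat.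
  by rewrite scale_scalar_mx mulr1.
have A1 : A 1 = 2%:R *: W.
  by rewrite /A /pencil subrr scale0r addr0 -[1 + 1]/(2%:R : R) rmorph_nat.
have b1 : b 1 != 0 by rewrite /b B1 det_scalar expf_neq0.
have V1 : V 1 = z *: swapmx.
  rewrite /V A1 B1 invmx_scalar -scalemxAl mul_mx_scalar scalerA divff // scale1r.
  by rewrite /W -scalemxAr mulmxA; case: uU => -> _; rewrite mul1mx.
have good1 : \det (defect_mx beta (V 1) 1) != 0.
  have := defect_mx_scale beta z swapmx 1; rewrite zz mul1r scale1r V1 => ->.
  exact: det_defect_swapmx.
have h1 : h 1 != 0.
  apply: (mulf_neq0 _ b1); rewrite (DXV _ b1) detZ; apply: (mulf_neq0 _ good1).
  by apply: expf_neq0; apply: mulf_neq0; rewrite ?conjc_eq0.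
have B0 : B 0 = A 0 by rewrite /A /B !subr0 !addr0.
have b0 : b 0 != 0.
  by rewrite /b /B /pencil subr0 addr0 !scale1r.
have V0 : V 0 = U.
  by rewrite /V -B0 mulmxV ?mulmx1 // unitmxE unitfE.
have [cb cX _] := entries _ (star_closed_tendsto R 0 (nbhs_filter (0 : R)))
  tendsto_real_complex.
(* This quotient agrees with the entry of [V t] wherever [b t != 0], and its limit follows from
   those of [b] and [X]. *)
have cV i j : tendsto (nbhs (0 : R)) (fun t => (b t)^-1 * X t i j) (U i j).
  rewrite -V0 (_ : V 0 i j = (b 0)^-1 * X 0 i j); last first.
    by rewrite XV // [in RHS]mxE mulKf.
  by apply: tendstoM; [apply: tendstoV | apply: cX].
pose S i j t := `|U i j - (b t)^-1 * X t i j| < e%:C.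
have close : nbhs (0 : R) [set t | forall i j, S i j t]%classic.
  apply: (@filter_forall _ _ (fun i t => forall j, S i j t) (nbhs (0 : R)) _) => i.
  apply: (@filter_forall _ _ (S i) (nbhs (0 : R)) _) => j.
  by apply: (tendstoP _ _).1 (cV i j) _ _; rewrite ltcR.
move/nbhs_ballP: close => [d /= d0 close].
(* [h 1 != 0] makes [h] a nonzero polynomial function, so it has nonzero values within the radius
   [d] that guarantees closeness to [U]. *)
have [t [t0 td ht]] := real_polyfun_neq0_near0 hpoly h1 d0.
have bt : b t != 0 by apply: contraNneq ht => bt; rewrite /h bt mulr0.
exists (V t); split; last first.
  move=> i j; rewrite (_ : V t i j = (b t)^-1 * X t i j); last first.
    by rewrite XV // [in RHS]mxE mulKf.
  by apply: close; rewrite /ball /= sub0r normrN gtr0_norm.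
split; first exact: uV.
by apply: contraNneq ht => dV; rewrite /h DXV // detZ dV mulr0 mul0r.
Qed.

Unset Implicit Arguments.

Theorem theorem1 (R : realType) (n : nat) (hn : (2 <= n)%N)
  (beta : 'M[R[i]]_n) (hbeta : density_matrix beta)
  (hpos : forall a : R[i], eigenvalue beta a -> 0 < a) :
  exists O : 'M[R[i]]_(n * n) -> Prop,
    [/\ open_in_unitary O, dense_in_unitary O &
        forall U, O U ->
          exists! Q : 'M[R[i]]_n, density_matrix Q /\ PhiU beta U Q = Q].
Proof.
exists (fun U => unitary U /\ \det (defect_mx beta U 1) != 0); split.
- exact: open_good.
- exact: dense_good.
- by move=> U [uU detU]; apply: unique_fixpoint.
Qed.
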